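(* The chromatic numbers of the six signed Petersen graphs are $\chi(+P)=\chi(P_1)=\chi(P_{2,2})=\chi(P_{2,3})=\chi(P_{3,2})=\chi(P_{3,3})=1$, and the zero-free chromatic numbers are $\chi^*(+P)=\chi^*(P_1)=\chi^*(P_{2,2})=\chi^*(P_{2,3})=\chi^*(P_{3,2})=2$ and $\chi^*(P_{3,3})=1$.
   Context: The Petersen graph $P$ has vertices $v_{ij}$ for the 2-element subsets $\{i,j\}\subseteq\{1,\dots,5\}$, with $v_{ij}v_{kl}$ an edge iff $\{i,j\}\cap\{k,l\}=\emptyset$. For a signed graph $\Sigma=(\Gamma,\sigma)$, a proper $k$-coloration is $\kappa:V\to\{0,\pm1,\dots,\pm k\}$ with $\kappa(w)\ne\sigma(vw)\kappa(v)$ for every edge $vw$; $\chi(\Sigma)$ is the least $k\ge0$ admitting a proper $k$-coloration and $\chi^*(\Sigma)$ the least $k$ admitting one that never uses 0. Edge distance is distance in the line graph; disjoint edges of $P$ have distance 2 if some edge joins them, 3 otherwise. $+P$: all edges positive; $P_1$: one negative edge; $P_{2,2}$/$P_{2,3}$: two negative edges at distance 2/3; $P_{3,2}$: three negative edges forming alternate edges of a 6-cycle; $P_{3,3}$: three negative edges pairwise at distance 3. *)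

(* Defs.v *)
From mathcomp Require Import all_boot all_order all_algebra.
From mathcomp Require Import boolp.

Set Implicit Arguments.
Unset Strict Implicit.
Unset Printing Implicit Defensive.

Import Order.TTheory GRing.Theory Num.Theory.
Local Open Scope ring_scope.

Record sgraph := SGraph {
  vertex :> finType;
  adj : rel vertex;
  adj_sym : symmetric adj;
  adj_irr : irreflexive adj }.

Section Graphs.
Variable G : sgraph.

Definition is_edge (e : {set G}) : bool :=
  [exists x : G, exists y : G, adj x y && (e == [set x; y])].

Definition edge := {e : {set G} | is_edge e}.

Definition at_distance (n : nat) (x y : G) : Prop :=
  (exists p : seq G, [/\ path (@adj G) x p, last x p = y & size p = n]) /\
  (forall p : seq G, path (@adj G) x p -> last x p = y -> (n <= size p)%N).

Definition ladj : rel edge :=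
  fun e f => (e != f) && (val e :&: val f != set0).

Lemma ladj_sym : symmetric ladj.
Proof. by move=> e f; rewrite /ladj eq_sym setIC. Qed.

Lemma ladj_irr : irreflexive ladj.
Proof. by move=> e; rewrite /ladj eqxx. Qed.

Definition line_graph : sgraph := SGraph ladj_sym ladj_irr.

End Graphs.

Definition edge_distance (G : sgraph) (n : nat) (e f : edge G) : Prop :=
  @at_distance (line_graph G) n e f.

(* A sign is a boolean, [true] meaning negative: the sign as an integer is
   [(-1) ^+ s]. *)
Definition signature (G : sgraph) : Type := edge G -> bool.

Section Coloration.
Variables (G : sgraph) (sigma : signature G).

Definition negative_edges : {set edge G} := [set e | sigma e].

Definition proper (k : nat) (kappa : G -> int) : Prop :=
  (forall v : G, `|kappa v| <= k%:Z) /\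
  (forall (e : edge G) (v w : G),
     val e = [set v; w] -> kappa w <> (-1) ^+ sigma e * kappa v).

Definition colorable (k : nat) : Prop :=
  exists kappa : G -> int, proper k kappa.

Definition zero_free_colorable (k : nat) : Prop :=
  exists2 kappa : G -> int, proper k kappa & forall v : G, kappa v <> 0.

Lemma edge_neq (e : edge G) (v w : G) : val e = [set v; w] -> v != w.
Proof.
move=> Ee; apply/eqP => Evw; case/existsP: (valP e) => x /existsP[y] /andP[xy].
rewrite Ee {}Evw => /eqP /setP E.
have := E x; have := E y; rewrite !inE !eqxx orbT !orbb => /eqP Ey /eqP Ex.
by rewrite Ex Ey adj_irr in xy.
Qed.

Lemma zero_free_colorable_card : zero_free_colorable #|G|.
Proof.
exists (fun v => (enum_rank v).+1%:Z) => [|v //]; split=> [v|e v w Ee].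
  by rewrite ger0_norm // lez_nat.
case: (sigma e) => //=; rewrite ?expr0 ?expr1 ?mulN1r ?mul1r //.
by case=> /ord_inj /enum_rank_inj Ewv; have := edge_neq Ee; rewrite Ewv eqxx.
Qed.

Lemma colorable_ex : exists k, `[< colorable k >].
Proof.
by exists #|G|; apply/asboolP; have [kappa ? _] := zero_free_colorable_card;
   exists kappa.
Qed.

Lemma zero_free_colorable_ex : exists k, `[< zero_free_colorable k >].
Proof. by exists #|G|; apply/asboolP; exact: zero_free_colorable_card. Qed.

Definition chi : nat := ex_minn colorable_ex.

Definition chi_star : nat := ex_minn zero_free_colorable_ex.

End Coloration.

(* The index set {1, ..., 5} is represented by ['I_5]. *)
Definition pvertex := {A : {set 'I_5} | #|A| == 2%N}.

Definition padj : rel pvertex := fun u v => val u :&: val v == set0.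

Lemma padj_sym : symmetric padj.
Proof. by move=> u v; rewrite /padj setIC. Qed.

Lemma padj_irr : irreflexive padj.
Proof.
move=> u; rewrite /padj setIid; apply/negP => /eqP u0.
by have := valP u; rewrite /= u0 cards0.
Qed.

Definition petersen : sgraph := SGraph padj_sym padj_irr.

Definition is_plusP (sigma : signature petersen) : Prop :=
  negative_edges sigma = set0.

Definition is_P1 (sigma : signature petersen) : Prop :=
  exists e, negative_edges sigma = [set e].

(* [is_P2 2] describes P_{2,2} and [is_P2 3] describes P_{2,3}. *)
Definition is_P2 (d : nat) (sigma : signature petersen) : Prop :=
  exists e f, negative_edges sigma = [set e; f] /\ edge_distance d e f.

Definition is_P32 (sigma : signature petersen) : Prop :=
  exists v0 v1 v2 v3 v4 v5 : petersen,
    ucycle (@adj petersen) [:: v0; v1; v2; v3; v4; v5] /\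
    [set val e | e in negative_edges sigma] =
      [set [set v0; v1]; [set v2; v3]; [set v4; v5]].

Definition is_P33 (sigma : signature petersen) : Prop :=
  exists e f g, negative_edges sigma = [set e; f; g] /\
    [/\ edge_distance 3 e f, edge_distance 3 e g & edge_distance 3 f g].

(* Main.v *)
(* The vertices of P containing a fixed point z are independent, and the six
   others induce a perfect matching; so colouring the former 0, or 2, and
   the latter suitably by ±1 shows chi <= 1 and chi* <= 2 for every signature.
   Moreover chi* = 1 iff there is a function b with b v = b w exactly on the
   negative edges vw, which forces every closed walk to have an even number of
   positive edges.  Some pentagon violates this in all cases but P_{3,3}; there
   the negative edges are the three edges missing some point m, and b v is the
   truth value of m \in v. *)
Require Import Defs.
From mathcomp Require Import all_boot all_order all_algebra.
From mathcomp Require Import boolp.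

Set Implicit Arguments.
Unset Strict Implicit.
Unset Printing Implicit Defensive.

Import Order.TTheory GRing.Theory Num.Theory.

(** * Signed graphs: zero-free 1-colorations, closed walks, chromatic numbers *)

Section SignedGraph.
Variables (G : sgraph) (sigma : signature G).
Implicit Types (e : edge G) (v w : G) (S : {set {set G}}).

(** Recording negative edges as vertex pairs lets the sign of vw be read off as a membership, with
    no element of [edge G] at hand. *)
Definition negative_pairs : {set {set G}} :=
  [set val e | e in negative_edges sigma].

Lemma mem_negative_pairs e : (val e \in negative_pairs) = sigma e.
Proof. by rewrite mem_imset ?inE //; apply: val_inj. Qed.

Lemma adj_edge v w : adj v w -> exists e, val e = [set v; w].
Proof.
move=> vw; have E : is_edge [set v; w].
  by apply/existsP; exists v; apply/existsP; exists w; rewrite vw eqxx.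
by exists (Sub [set v; w] E); rewrite SubK.
Qed.

Lemma edge_ends e : exists v w, adj v w /\ val e = [set v; w].
Proof.
by case/existsP: (valP e) => v /existsP[w] /andP[vw /eqP Ee]; exists v, w.
Qed.

Lemma set2_adj e v w : val e = [set v; w] -> adj v w.
Proof.
move=> Ee; have vw := edge_neq Ee.
have [x [y [xy Exy]]] := edge_ends e; move: Ee; rewrite Exy => E.
have : v \in [set x; y] by rewrite E set21.
have : w \in [set x; y] by rewrite E set22.
rewrite !inE => /orP[] /eqP Ew /orP[] /eqP Ev; subst v w.
- by rewrite eqxx in vw.
- by rewrite adj_sym.
- by [].
- by rewrite eqxx in vw.
Qed.

Lemma properP k (kappa : G -> int) :
  Defs.proper sigma k kappa <->
  (forall v, `|kappa v| <= k%:Z)%R /\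
  (forall v w, adj v w ->
     kappa w <> ((-1) ^+ ([set v; w] \in negative_pairs) * kappa v)%R).
Proof.
split=> -[bd pr]; split=> //.
  move=> v w /adj_edge[e Ee].
  by rewrite -Ee mem_negative_pairs; apply: pr.
by move=> e v w Ee; rewrite -mem_negative_pairs Ee; apply/pr/(set2_adj Ee).
Qed.

(** Switching at the vertices where [b] holds makes every edge negative. *)
Definition antibalanced S (b : G -> bool) : Prop :=
  forall v w, adj v w -> b w = b v (+) ([set v; w] \notin S).

(** All values are ±1, so differing from the signed value of a neighbour means being its opposite:
    negative edges keep the sign of [kappa] and positive ones reverse it. Take for [b] the
    positivity of [kappa]. *)
Lemma zero_free1P :
  zero_free_colorable sigma 1 <-> exists b, antibalanced negative_pairs b.
Proof.
split=> [[kappa /properP[bd pr] nz]|[b bP]].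
  exists (fun v => (0 < kappa v)%R) => v w /pr.
  have pm u : kappa u = 1%R \/ kappa u = (-1)%R.
    by have := bd u; have := nz u; case: (kappa u) => [[|[|n]]|[|n]] //; [left | right].
  by case: (_ \in _); case: (pm v) => ->; case: (pm w) => ->.
exists (fun v => if b v then 1 else -1)%R => [|v]; last by case: (b v).
apply/properP; split=> [v|v w /bP ->]; first by case: (b v).
by case: (_ \in _); case: (b v).
Qed.

Lemma antibalanced_closed_walk S b v (p : seq G) :
  antibalanced S b -> path (@adj G) v p -> last v p = v ->
  ~~ odd (count id (pairmap (fun x y => [set x; y] \notin S) v p)).
Proof.
move=> bP vp lp.
(* Induction needs walks with an arbitrary end: [b] flips once for each positive step. *)
suff : b (last v p) =
    b v (+) odd (count id (pairmap (fun x y => [set x; y] \notin S) v p)).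
  by rewrite lp; case: (b v); case: odd.
elim: p v vp {lp} => [|w p IHp] v /=; first by rewrite addbF.
case/andP=> vw /IHp ->; rewrite oddD (bP _ _ vw).
by case: (b v); case: (_ \notin _); case: odd.
Qed.

Lemma colorable0 v w : adj v w -> ~ colorable sigma 0.
Proof.
move=> vw [kappa /properP[bd pr]]; apply: (pr _ _ vw).
have k0 u : kappa u = 0%R by apply/eqP; rewrite -normr_le0.
by rewrite !k0 mulr0.
Qed.

Lemma zero_free_colorable_weaken k :
  zero_free_colorable sigma k -> colorable sigma k.
Proof. by case=> kappa ? _; exists kappa. Qed.

Lemma chi_eq1 v w : adj v w -> colorable sigma 1 -> chi sigma = 1.
Proof.
move=> vw c1; rewrite /chi; case: ex_minnP => k /asboolP ck /(_ 1).
case: k ck => [/(colorable0 vw)//|k _].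
by move/(_ (introT (asboolP _) c1)); case: k.
Qed.

Lemma chi_star_eq1 v w :
  adj v w -> zero_free_colorable sigma 1 -> chi_star sigma = 1.
Proof.
move=> vw c1; rewrite /chi_star; case: ex_minnP => k /asboolP ck /(_ 1).
case: k ck => [/zero_free_colorable_weaken/(colorable0 vw)//|k _].
by move/(_ (introT (asboolP _) c1)); case: k.
Qed.

Lemma chi_star_eq2 v w : adj v w -> ~ zero_free_colorable sigma 1 ->
  zero_free_colorable sigma 2 -> chi_star sigma = 2.
Proof.
move=> vw c1 c2; rewrite /chi_star; case: ex_minnP => k /asboolP ck /(_ 2).
case: k ck => [/zero_free_colorable_weaken/(colorable0 vw)//|[/c1//|k _]].
by move/(_ (introT (asboolP _) c2)); case: k.
Qed.

(** Otherwise the line graph has a walk from [e] to [f] of length 0 (equal edges), 1 (a common end)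
    or 2 (through an edge joining them). *)
Lemma edge_distance3_far (e f : edge G) v w : edge_distance 3 e f ->
  v \in val e -> w \in val f -> (v != w) && ~~ adj v w.
Proof.
case=> _ far ve wf.
have disj x : x \in val e -> x \in val f -> False.
  move=> xe xf; have [Eef|ef] := eqVneq e f; first by have := far [::] isT Eef.
  have := far [:: f]; rewrite /= andbT; case/(_ _ erefl)/idPn=> //.
  by rewrite /ladj ef; apply/set0Pn; exists x; rewrite inE xe.
apply/andP; split; first by apply/eqP => Evw; subst w; apply: disj wf.
apply/negP => /adj_edge[g Eg].
have eg : ladj e g.
  apply/andP; split; last by apply/set0Pn; exists v; rewrite inE ve Eg set21.
  by apply/eqP => Eeg; apply: (disj w) => //; rewrite Eeg Eg set22.
have gf : ladj g f.
  apply/andP; split; last by apply/set0Pn; exists w; rewrite inE wf Eg set22.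
  by apply/eqP => Egf; apply: (disj v) => //; rewrite -Egf Eg set21.
by have := far [:: g; f]; rewrite /= eg gf => /(_ isT erefl).
Qed.

End SignedGraph.

(** * Colorations of the Petersen graph from a fixed point z *)

Section MatchingColoring.
Variables (sigma : signature petersen) (z y : 'I_5) (c : int).
Hypotheses (zy : z != y) (c0 : c <> 1%R) (c1 : c <> (-1)%R).
Implicit Types v w : petersen.

(** The point z and the two disjoint pairs exhaust the five points, so a vertex missing z has only
    one possible neighbour missing z. *)
Lemma petersen_cover v w : adj v w -> z \notin val v -> z \notin val w ->
  val w = ~: (z |: val v).
Proof.
move=> vw zv zw; apply/eqP; rewrite eqEcard; apply/andP; split.
  apply/subsetP => x xw; rewrite !inE negb_or; apply/andP; split.
    by apply: contraNneq zw => <-.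
  by apply/negP => xv; move/eqP/setP/(_ x): vw; rewrite !inE xv xw.
by have := cardsC (z |: val v); rewrite cardsU1 zv (eqP (valP v))
  (eqP (valP w)) card_ord => /eqP; rewrite -[5]/(3 + 2) eqn_add2l => /eqP ->.
Qed.

(* The edges missing z form a matching, and exactly one end of each contains y. *)
Definition matching_coloring v : int :=
  if z \in val v then c else
  if (y \in val v) || [exists w : petersen, [&& adj v w, z \notin val w &
                            [set v; w] \in negative_pairs sigma]]
  then 1%R else (-1)%R.

(** Two vertices containing z are not adjacent, and [c] is not ±1. On a matching edge, the end
    containing y gets 1, and the other end gets 1 if the edge is negative, -1 if it is positive. *)
Lemma matching_coloring_proper v w : adj v w -> matching_coloring w <>
  ((-1) ^+ ([set v; w] \in negative_pairs sigma) * matching_coloring v)%R.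
Proof.
move=> vw; have wv : adj w v by rewrite adj_sym.
(* As the neighbour missing z is unique, the existential is just the sign of the matching edge. *)
have mate (a b : petersen) : adj a b -> z \notin val a -> z \notin val b ->
    [exists w : petersen, [&& adj a w, z \notin val w &
                  [set a; w] \in negative_pairs sigma]]
    = ([set a; b] \in negative_pairs sigma).
  move=> ab za zb; apply/existsP/idP => [[x /and3P[ax zx]]|abS].
    suff -> : x = b by [].
    by apply: val_inj; rewrite (petersen_cover ax) // (petersen_cover ab).
  by exists b; rewrite ab zb.
rewrite /matching_coloring.
have [zv|zv] := boolP (z \in val v); have [zw|zw] := boolP (z \in val w).
- by move/eqP/setP/(_ z): vw; rewrite !inE zv zw.
- case: ifP => _; case: (_ \in _); rewrite ?mulN1r ?mul1r => Ec.
  + by apply: c1; rewrite Ec opprK.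
  + exact: c0.
  + by apply: c0; apply: oppr_inj.
  + exact: c1.
- by case: ifP => _; case: (_ \in _).
rewrite (mate _ _ vw) // (mate _ _ wv) // (setUC [set w]).
rewrite (petersen_cover vw) // !inE (eq_sym y) (negbTE zy) /=.
by case: (y \in val v); case: (_ \in _).
Qed.

End MatchingColoring.

Lemma petersen_colorable1 sigma : @colorable petersen sigma 1.
Proof.
exists (matching_coloring sigma ord0 ord_max 0%R); apply/properP; split=> [v|].
  by rewrite /matching_coloring; do 2 case: ifP => // _.
exact: matching_coloring_proper.
Qed.

Lemma petersen_zero_free_colorable2 sigma :
  @zero_free_colorable petersen sigma 2.
Proof.
exists (matching_coloring sigma ord0 ord_max 2%R) => [|v]; last first.
  by rewrite /matching_coloring; do 2 case: ifP => // _.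
apply/properP; split=> [v|]; last exact: matching_coloring_proper.
by rewrite /matching_coloring; do 2 case: ifP => // _.
Qed.

(** * The Petersen graph on codes, and the finite checks *)

(* The pair (i, j) with i < j < 5 codes the vertex {i, j}; the codes allow the
   remaining finite case analyses to be computed. *)
Definition code : Type := nat * nat.

Implicit Types (p q : code) (e f g : code * code) (es : seq (code * code)).

Definition codes : seq code := [seq (i, j) | j <- iota 0 5, i <- iota 0 j].

Definition cadj p q : bool :=
  [&& p.1 != q.1, p.1 != q.2, p.2 != q.1 & p.2 != q.2].

(** Every edge is listed in both orientations, hence the comparison up to reversal in
    [same_ends]. *)
Definition cedges : seq (code * code) :=
  [seq e <- [seq (p, q) | p <- codes, q <- codes] | cadj e.1 e.2].

Definition same_ends e f : bool := (e == f) || (e == (f.2, f.1)).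

Definition far e f : bool :=
  all (fun p => all (fun q => (p != q) && ~~ cadj p q) [:: f.1; f.2])
      [:: e.1; e.2].

Definition neighbors p : seq code := [seq q <- codes | cadj p q].
Arguments neighbors : simpl never.

(** As for [path], the start is left out of the list; a closed walk therefore ends with its
    start. *)
Fixpoint walks n p : seq (seq code) :=
  if n is n'.+1 then
    [seq q :: s | q <- neighbors p, s <- walks n' q]
  else [:: [::]].

Definition closed_walks n : seq (code * seq code) :=
  [seq w <- [seq (p, s) | p <- codes, s <- walks n p] | last w.1 w.2 == w.1].

(** The girth is 5, so these closed walks are 5-cycles, listed from each start in each direction. *)
Definition pentagons := closed_walks 5.

Definition positive es p q : bool := ~~ has (same_ends (p, q)) es.

Definition odd_pentagon es : bool :=
  has (fun w => odd (count id (pairmap (positive es) w.1 w.2))) pentagons.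

Definition hexagon_matching (w : code * seq code) : seq (code * code) :=
  if w is (p0, [:: p1; p2; p3; p4; p5; _]) then
    [:: (p0, p1); (p2, p3); (p4, p5)] else [::].

Definition star_coloring (m : nat) p : bool := (m == p.1) || (m == p.2).

Definition star_antibalanced es (m : nat) : bool :=
  all (fun e => star_coloring m e.2
                  == star_coloring m e.1 (+) positive es e.1 e.2) cedges.

(** There are 12 pentagons and each edge lies on 4 of them, so some pentagon avoids both edges and
    has five positive edges. *)
Lemma two_edges_odd_pentagon :
  all (fun e => all (fun f => odd_pentagon [:: e; f]) cedges) cedges.
Proof. by vm_compute. Qed.

(** The path p0 p1 p2 p3 closes to a pentagon through the common neighbour of p0 and p3. It contains
    two of the negative edges but not p4 p5, leaving three positive edges. *)
Lemma hexagon_odd_pentagon :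
  all (fun w => odd_pentagon (hexagon_matching w))
      [seq w <- closed_walks 6 | uniq w.2].
Proof. by vm_compute. Qed.

(** If an edge joins ab to cd and misses m, the vertices far from both ends are ac, ad, bc and bd,
    whose two edges also miss m. So the three edges are all those missing m; on any other edge
    exactly one end contains m. *)
Lemma far_edges_star :
  all (fun e => all (fun f => all (fun g =>
      has (star_antibalanced [:: e; f; g]) (iota 0 5))
    [seq g <- cedges | far e g && far f g])
    [seq f <- cedges | far e f]) cedges.
Proof. by vm_compute. Qed.

(** * The correspondence between codes and vertices *)

Lemma default_vertex_subproof : #|[set ord0; ord_max : 'I_5]| == 2.
Proof. by rewrite cards2. Qed.

Definition vertex_of p : petersen :=
  insubd (exist (fun A : {set _} => #|A| == 2) _ default_vertex_subproof) [set inord p.1; inord p.2].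

Lemma codes_lt p : p \in codes -> p.1 < p.2 < 5.
Proof. by move: p; apply/allP. Qed.

Lemma val_vertex_of p :
  p \in codes -> val (vertex_of p) = [set inord p.1; inord p.2].
Proof.
case/codes_lt/andP=> p12 p2; rewrite /vertex_of val_insubd cards2.
by rewrite -val_eqE /= !inordK ?(ltn_trans p12) // (ltn_eqF p12).
Qed.

Lemma mem_vertex_of m p : m < 5 -> p \in codes ->
  (inord m \in val (vertex_of p)) = star_coloring m p.
Proof.
move=> m5 pc; rewrite val_vertex_of // !inE -!val_eqE /=.
by have /andP[p12 p2] := codes_lt pc; rewrite !inordK ?(ltn_trans p12).
Qed.

(** A vertex is determined by which of the five points it contains; on codes this is a finite
    check. *)
Lemma vertex_of_inj : {in codes &, injective vertex_of}.
Proof.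
move=> p q pc qc Epq.
have E m : m < 5 -> star_coloring m p = star_coloring m q.
  by move=> m5; rewrite -!mem_vertex_of // Epq.
have {E} : all (fun m => star_coloring m p == star_coloring m q) (iota 0 5).
  by apply/allP => m; rewrite mem_iota => /E ->.
suff /allP/(_ p pc)/allP/(_ q qc)/implyP Inj : all (fun p => all (fun q =>
    all (fun m => star_coloring m p == star_coloring m q) (iota 0 5)
      ==> (p == q)) codes) codes by move/Inj/eqP.
by vm_compute.
Qed.

Lemma vertex_ofP (v : petersen) : exists2 p, p \in codes & v = vertex_of p.
Proof.
have /cards2P[i [j [ij Ev]]] : #|val v| == 2 := valP v.
wlog lt_ij : i j ij Ev / i < j.
  move=> IH; have [||] := ltngtP i j; first exact: IH.
    by apply: IH; rewrite 1?eq_sym 1?setUC.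
  by move/val_inj/eqP; rewrite (negbTE ij).
have pc : (val i, val j) \in codes.
  by apply/allpairsPdep; exists (val j), (val i); rewrite !mem_iota /= !add0n.
by exists (val i, val j) => //; apply: val_inj; rewrite val_vertex_of //= !inord_val.
Qed.

Lemma adj_vertex_of p q : p \in codes -> q \in codes ->
  adj (vertex_of p) (vertex_of q) = cadj p q.
Proof.
move=> pc qc; rewrite /= /padj setI_eq0 (val_vertex_of qc).
rewrite disjoint_sym disjoints_subset subUset !sub1set !inE.
have /andP[q12 q2] := codes_lt qc; have q1 := ltn_trans q12 q2.
rewrite !mem_vertex_of // /star_coloring !negb_or /cadj.
by rewrite (eq_sym q.1) (eq_sym q.1) (eq_sym q.2) (eq_sym q.2); do !case: eqP.
Qed.

Definition vedge e : {set petersen} := [set vertex_of e.1; vertex_of e.2].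

Lemma mem_cedges p q :
  ((p, q) \in cedges) = [&& p \in codes, q \in codes & cadj p q].
Proof.
rewrite mem_filter andbC andbA; congr (_ && _).
by apply/allpairsP/andP => [[[p' q'] [? ? [-> ->]]]|[pc qc]]; last by exists (p, q).
Qed.

Lemma codesP p q : (p, q) \in cedges -> p \in codes /\ q \in codes.
Proof. by rewrite mem_cedges => /and3P[]. Qed.

Lemma vedge_eq e p q : e \in cedges -> p \in codes -> q \in codes ->
  (vedge (p, q) == vedge e) = same_ends (p, q) e.
Proof.
case: e => p' q' /codesP[p'c q'c] pc qc.
rewrite /same_ends /vedge /= !xpair_eqE.
have vE := inj_in_eq vertex_of_inj.
apply/eqP/orP => [E|[]/andP[/eqP-> /eqP->]//]; last by rewrite setUC.
have : vertex_of p \in vedge (p', q') by rewrite /vedge /= -E set21.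
have : vertex_of q \in vedge (p', q') by rewrite /vedge /= -E set22.
have : vertex_of p' \in vedge (p, q) by rewrite /vedge /= E set21.
have : vertex_of q' \in vedge (p, q) by rewrite /vedge /= E set22.
rewrite !inE /= !vE // (eq_sym q') (eq_sym q' q) (eq_sym p') (eq_sym p' q).
by do 4 case: (_ == _) => //; auto.
Qed.

Lemma edge_vedge (a : edge petersen) : exists2 e, e \in cedges & val a = vedge e.
Proof.
have [v [w [vw Ea]]] := edge_ends a.
have [p pc Ev] := vertex_ofP v; have [q qc Ew] := vertex_ofP w; subst v w.
by exists (p, q); rewrite // mem_cedges pc qc -adj_vertex_of.
Qed.

(** * Transfer of signs, walks and distances from codes to the graph *)

Lemma notin_vedges es p q : {subset es <= cedges} ->
  p \in codes -> q \in codes ->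
  ([set vertex_of p; vertex_of q] \notin [set:: map vedge es])
    = positive es p q.
Proof.
move=> sub pc qc; rewrite /positive inE -has_pred1 has_map; congr negb.
by apply: eq_in_has => e /sub ec /=; rewrite eq_sym -vedge_eq.
Qed.

Lemma mem_walks n p s :
  (s \in walks n p) = [&& size s == n, path cadj p s & all (mem codes) s].
Proof.
elim: n p s => [|n IHn] p [|q s] //=.
  by apply/allpairsPdep => -[? [? []]].
apply/allpairsPdep/and3P => [[q' [s' [q'p s'q' [-> ->]]]]|[sn /andP[pq qs] /andP[qc sc]]].
  by move: q'p s'q'; rewrite mem_filter IHn => /andP[-> ->] /and3P[/eqP-> -> ->].
by exists q, s; rewrite mem_filter IHn pq qc -eqSS sn qs sc.
Qed.

Lemma mem_closed_walks n p s : ((p, s) \in closed_walks n) =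
  [&& last p s == p, p \in codes, size s == n, path cadj p s & all (mem codes) s].
Proof.
rewrite mem_filter; congr (_ && _).
apply/allpairsPdep/andP => [[q [t [qc tq [-> ->]]]]|[pc ?]].
  by rewrite -mem_walks.
by exists p, s; rewrite mem_walks.
Qed.

Lemma path_vertex_of p s : p \in codes -> all (mem codes) s ->
  path (@adj petersen) (vertex_of p) (map vertex_of s) = path cadj p s.
Proof.
elim: s p => //= q s IHs p pc /andP[qc sc].
by rewrite IHs // -adj_vertex_of.
Qed.

Lemma odd_pentagon_unbalanced es b : {subset es <= cedges} ->
  odd_pentagon es -> ~ antibalanced [set:: map vedge es] b.
Proof.
move=> sub /hasP[[p s]]; rewrite mem_closed_walks.
case/and5P=> /eqP lp pc _ ps sc odd_s bP.
have := antibalanced_closed_walk bP (v := vertex_of p) (p := map vertex_of s).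
rewrite path_vertex_of // last_map lp => /(_ ps erefl)/negP; apply.
move: odd_s => /=; congr (is_true (odd (count _ _))).
(* The two lists of signs agree step by step. Closedness is dropped first, as it does not pass to
   tails. *)
elim: s p pc {lp ps} sc => //= q s IHs p pc /andP[qc sc].
by rewrite notin_vedges // -IHs.
Qed.

Lemma star_antibalancedP es m : {subset es <= cedges} -> m < 5 ->
  star_antibalanced es m ->
  antibalanced [set:: map vedge es] (fun v : petersen => inord m \in val v).
Proof.
move=> sub m5 /allP bal v w.
have [p pc ->] := vertex_ofP v; have [q qc ->] := vertex_ofP w.
rewrite adj_vertex_of // => pq; rewrite notin_vedges // !mem_vertex_of //.
by apply/eqP/(bal (p, q)); rewrite mem_cedges pc qc.
Qed.

Lemma vedge_far (a b : edge petersen) e f : e \in cedges -> f \in cedges ->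
  val a = vedge e -> val b = vedge f -> edge_distance 3 a b -> far e f.
Proof.
case: e f => [p q] [p' q'] /codesP[pc qc] /codesP[p'c q'c] Ea Eb /edge_distance3_far ab.
have far_ends x y : x \in codes -> y \in codes -> vertex_of x \in val a ->
    vertex_of y \in val b -> (x != y) && ~~ cadj x y.
  move=> xc yc xa yb; rewrite -adj_vertex_of //.
  by have := ab _ _ xa yb; rewrite (inj_in_eq vertex_of_inj).
by rewrite /far /= !andbT !far_ends // ?Ea ?Eb ?set21 ?set22.
Qed.

(** * The chromatic numbers of the six signed graphs *)

Lemma petersen_adj : exists v w : petersen, adj v w.
Proof.
exists (vertex_of (0, 1)), (vertex_of (2, 3)).
by rewrite adj_vertex_of.
Qed.

Lemma petersen_chi (sigma : signature petersen) : chi sigma = 1.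
Proof.
by have [v [w vw]] := petersen_adj; apply/(chi_eq1 vw)/petersen_colorable1.
Qed.

Lemma petersen_chi_star2 (sigma : signature petersen) es :
  {subset es <= cedges} -> negative_pairs sigma = [set:: map vedge es] ->
  odd_pentagon es -> chi_star sigma = 2.
Proof.
move=> sub Esigma odd_es; have [v [w vw]] := petersen_adj.
apply: (chi_star_eq2 vw); last exact: petersen_zero_free_colorable2.
case/zero_free1P=> b; rewrite Esigma; exact: odd_pentagon_unbalanced.
Qed.

Lemma chi_star_plusP (sigma : signature petersen) :
  is_plusP sigma -> chi_star sigma = 2.
Proof.
move=> Esigma; apply: (petersen_chi_star2 (es := [::])) => //.
by apply/setP => A; rewrite /negative_pairs Esigma imset0 !inE.
Qed.

(** This serves $P_{2,2}$ and $P_{2,3}$, and also $P_1$ with [a] equal to [b]. *)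
Lemma chi_star_two_edges (sigma : signature petersen) (a b : edge petersen) :
  negative_edges sigma = [set a; b] -> chi_star sigma = 2.
Proof.
move=> Esigma; have [e ec Ea] := edge_vedge a; have [f fc Eb] := edge_vedge b.
apply: (petersen_chi_star2 (es := [:: e; f])).
- by apply/allP; rewrite /= ec fc.
- by apply/setP => A; rewrite /negative_pairs Esigma imsetU1 imset_set1 Ea Eb !inE.
- by have /allP/(_ e ec)/allP/(_ f fc) := two_edges_odd_pentagon.
Qed.

Lemma chi_star_P32 (sigma : signature petersen) :
  is_P32 sigma -> chi_star sigma = 2.
Proof.
case=> v0 [v1 [v2 [v3 [v4 [v5 [/andP[cyc unq] Esigma]]]]]].
have [p0 c0 E0] := vertex_ofP v0; have [p1 c1 E1] := vertex_ofP v1.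
have [p2 c2 E2] := vertex_ofP v2; have [p3 c3 E3] := vertex_ofP v3.
have [p4 c4 E4] := vertex_ofP v4; have [p5 c5 E5] := vertex_ofP v5.
subst v0 v1 v2 v3 v4 v5.
(* The hexagon as a closed walk from [p0]: its vertex list rotated by one, ending at [p0]. *)
set s := [:: p1; p2; p3; p4; p5; p0].
have sc : all (mem codes) s by rewrite /= c0 c1 c2 c3 c4 c5.
have ps : path cadj p0 s by rewrite -path_vertex_of.
have us : uniq s.
  rewrite -[s]/(rot 1 [:: p0; p1; p2; p3; p4; p5]) rot_uniq.
  exact: (@map_uniq _ _ vertex_of).
apply: (petersen_chi_star2 (es := hexagon_matching (p0, s))).
- apply/allP; move: ps => /= /and5P[? _ ? _ /and3P[? _ _]].
  by rewrite !mem_cedges c0 c1 c2 c3 c4 c5 /=; apply/and4P.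
- by apply/setP => A; rewrite /negative_pairs Esigma !inE orbA.
- have /allP := hexagon_odd_pentagon; apply.
  rewrite mem_filter us mem_closed_walks c0 ps sc.
  by rewrite /= eqxx.
Qed.

Lemma chi_star_P33 (sigma : signature petersen) :
  is_P33 sigma -> chi_star sigma = 1.
Proof.
case=> a [b [c [Esigma [ab ac bc]]]]; have [v [w vw]] := petersen_adj.
have [e ec Ea] := edge_vedge a; have [f fc Eb] := edge_vedge b.
have [g gc Ec] := edge_vedge c.
have /allP/(_ e ec)/allP/(_ f) := far_edges_star.
rewrite mem_filter fc (vedge_far ec fc Ea Eb ab) => /(_ isT)/allP/(_ g).
rewrite mem_filter gc (vedge_far ec gc Ea Ec ac) (vedge_far fc gc Eb Ec bc).
case/(_ isT)/hasP=> m; rewrite mem_iota => /= m5 star.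
apply: (chi_star_eq1 vw); apply/zero_free1P.
exists (fun v : petersen => inord m \in val v).
suff -> : negative_pairs sigma = [set:: map vedge [:: e; f; g]].
  by apply: star_antibalancedP => //; apply/allP; rewrite /= ec fc gc.
apply/setP => A; rewrite /negative_pairs Esigma !imsetU !imset_set1 Ea Eb Ec.
by rewrite !inE orbA.
Qed.

Theorem theorem9p2 :
  ((forall sigma : signature petersen, is_plusP sigma -> chi sigma = 1) /\
   (forall sigma : signature petersen, is_P1 sigma -> chi sigma = 1) /\
   (forall sigma : signature petersen, is_P2 2 sigma -> chi sigma = 1) /\
   (forall sigma : signature petersen, is_P2 3 sigma -> chi sigma = 1) /\
   (forall sigma : signature petersen, is_P32 sigma -> chi sigma = 1) /\
   (forall sigma : signature petersen, is_P33 sigma -> chi sigma = 1)) /\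
  ((forall sigma : signature petersen, is_plusP sigma -> chi_star sigma = 2) /\
   (forall sigma : signature petersen, is_P1 sigma -> chi_star sigma = 2) /\
   (forall sigma : signature petersen, is_P2 2 sigma -> chi_star sigma = 2) /\
   (forall sigma : signature petersen, is_P2 3 sigma -> chi_star sigma = 2) /\
   (forall sigma : signature petersen, is_P32 sigma -> chi_star sigma = 2) /\
   (forall sigma : signature petersen, is_P33 sigma -> chi_star sigma = 1)).
Proof.
split; first by do !split=> *; apply: petersen_chi.
split; first exact: chi_star_plusP.
split; first by move=> sigma [e Ee]; apply: (@chi_star_two_edges _ e e); rewrite setUid.
split; first by move=> sigma [e [f [/chi_star_two_edges]]].
split; first by move=> sigma [e [f [/chi_star_two_edges]]].
split; [exact: chi_star_P32 | exact: chi_star_P33].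
Qed.
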